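(* Let $g\in A[z;\sigma]$ be delay-free and semi-reduced, and let $\langle g\rangle:=\{fg\mid f\in A[z;\sigma]\}$ be the left ideal generated by $g$. Then the following are equivalent: (i) $\langle g\rangle$ is a direct summand of the left $\mathbb{F}[z]$-module $A[z;\sigma]$ (i.e. $\mathfrak{p}^{-1}(\langle g\rangle)$ is a $\sigma$-cyclic convolutional code); (ii) $\langle g\rangle$ is a direct summand of the ring $A[z;\sigma]$, i.e. there is a left ideal $J$ with $A[z;\sigma]=\langle g\rangle\oplus J$; (iii) $\xi(g)\in\mathcal{M}_{\mathrm{basic}}$.
   Context: Let $\mathbb{F}$ be a finite field with $q$ elements and $n\ge2$ a divisor of $q-1$. Let $A=\mathbb{F}\times\cdots\times\mathbb{F}$ ($n$ copies), elements written $[a_1,\dots,a_n]$, with $\mathbb{F}$ embedded diagonally; $e_i$ is the element with $1$ in position $i$ and $0$ elsewhere. Let $\sigma([a_1,\dots,a_n])=[a_n,a_1,\dots,a_{n-1}]$. $A[z;\sigma]$ is the skew polynomial ring of polynomials $\sum_\nu z^\nu a_\nu$ ($a_\nu\in A$, right coefficients) with multiplication determined by $az=z\sigma(a)$; it contains $\mathbb{F}[z]$ as a subring (since $\sigma$ fixes $\mathbb{F}$) and is a left $\mathbb{F}[z]$-module by left multiplication. Degree of $\sum z^\nu a_\nu$: largest $\nu$ with $a_\nu\ne0$. For $g\in A[z;\sigma]$: the components are $g^{(a)}=e_ag$, the support is $T_g=\{a\mid g^{(a)}\ne0\}$; $g$ is delay-free if $T_g=T_{g_0}$ where $g_0\in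 A$ is the constant term of $g$; each component has the form $\sum_j z^jc_{a,j}e_{(a+j-1\bmod n)+1}$ with $c_{a,j}\in\mathbb{F}$, and $g$ is semi-reduced if the leading coefficients of the components $g^{(a)}$, $a\in T_g$, lie in pairwise different ideals $\langle e_i\rangle$. Fix an $\mathbb{F}$-algebra isomorphism $\phi:\mathbb{F}[x]/\langle x^n-1\rangle\to A$ (it exists by the Chinese Remainder Theorem). Define $\mathfrak{p}:\mathbb{F}[z]^n\to A[z;\sigma]$ by $\sum_\nu z^\nu v_\nu\mapsto\sum_\nu z^\nu\phi(\sum_{i=0}^{n-1}v_{\nu,i}x^i)$ for $v_\nu=(v_{\nu,0},\dots,v_{\nu,n-1})\in\mathbb{F}^n$; it is an isomorphism of left $\mathbb{F}[z]$-modules. A $\sigma$-cyclic convolutional code is a submodule $\mathcal{C}\subseteq\mathbb{F}[z]^n$ that is a direct summand of $\mathbb{F}[z]^n$ and such that $\mathfrak{p}(\mathcal{C})$ is a left ideal of $A[z;\sigma]$. Let $\mathcal{M}=\{(m_{ab})\in\mathbb{F}[t]^{n\times n}\mid m_{ab}(0)=0\text{ for }1\le b<a\le n\}$. Writing $g=\sum_{l=0}^Nz^{nl}\sum_{i=0}^{n-1}z^i[c^l_{i1},\dots,c^l_{in}]$ uniquely, $\xi(g)$ is the matrix $(m_{ab})$ with $m_{ab}=\sum_lt^lc^l_{b-a,b}$ if $b\ge a$ and $m_{ab}=\sum_lt^{l+1}c^l_{n+b-a,b}$ if $b<a$; $\xi:A[z;\sigma]\to\mathcal{M}$ is a ring isomorphism.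 For $M\in\mathcal{M}$: $M$ is delay-free if $m_{aa}(0)\ne0$ for every index $a$ of a nonzero row of $M$. A matrix in $\mathbb{F}[t]^{k\times n}$ is basic if its $k\times k$ minors are coprime (equivalently it has rank $k$ at every point of an algebraic closure of $\mathbb{F}$). $\mathcal{M}_{\mathrm{basic}}$ is the set of $M\in\mathcal{M}$ that are delay-free and whose nonzero rows form a basic matrix. *)

(* Defs.v *)
From HB Require Import structures.
From mathcomp Require Import all_boot all_order all_algebra all_field.
Set Implicit Arguments. Unset Strict Implicit. Unset Printing Implicit Defensive.
Import GRing.Theory.
Local Open Scope ring_scope.

(* Conventions:
   - indices 1..n of the paper are the ordinals 0..n-1 of 'I_n;
   - A = F x ... x F is {ffun 'I_n -> F} with its pointwise ring structure;
   - a skewpoly polynomial  sum_nu z^nu a_nu  (a_nu in A) is stored by its n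
     coordinate polynomials: g : {ffun 'I_n -> {poly F}} with
     (g b)`_nu = a_nu b.  [coef g nu] recovers the coefficient a_nu in A. *)

Section SkewPoly.
Variables (F : finFieldType) (n : nat).

Definition Aelt := {ffun 'I_n -> F}.
Definition skewpoly := {ffun 'I_n -> {poly F}}.   (* A[z;sigma], additively *)

Definition e_ (i : 'I_n) : Aelt := [ffun j => if j == i then 1 else 0].

Lemma ord_pos (i : 'I_n) : (0 < n)%N.
Proof. exact: leq_ltn_trans (leq0n i) (ltn_ord i). Qed.

Definition ord_sub (i : 'I_n) (j : nat) : 'I_n :=
  Ordinal (ltn_pmod (i + (n - j %% n)) (ord_pos i)).

Definition sigma (a : Aelt) : Aelt := [ffun i => a (ord_sub i 1)].
Definition sigma_pow (j : nat) (a : Aelt) : Aelt := iter j sigma a.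

Definition coef (g : skewpoly) (k : nat) : Aelt := [ffun b => (g b)`_k].
Definition sz (g : skewpoly) : nat := \max_(b < n) size (g b).
Definition deg (g : skewpoly) : nat := (sz g).-1.
Definition lead (g : skewpoly) : Aelt := coef g (deg g).

Definition mk (c : nat -> Aelt) (N : nat) : skewpoly :=
  [ffun b => \poly_(k < N) c k b].

(* multiplication of A[z;sigma], determined by  a z = z sigma(a):
   (sum z^i a_i)(sum z^j b_j) = sum_k z^k sum_(i+j=k) sigma^j(a_i) b_j *)
Definition skew_mul (p q : skewpoly) : skewpoly :=
  mk (fun k => \sum_(i < k.+1) sigma_pow (k - i) (coef p i) * coef q (k - i))
     (sz p + sz q).

Definition constA (a : Aelt) : skewpoly := [ffun b => (a b)%:P].
Definition polF (f : {poly F}) : skewpoly := [ffun b => f].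

Definition gen_ideal (g : skewpoly) : skewpoly -> Prop :=
  fun h => exists f : skewpoly, h = skew_mul f g.

Definition Fz_submodule (N : skewpoly -> Prop) : Prop :=
  [/\ N 0, (forall x y, N x -> N y -> N (x + y))
         & (forall (f : {poly F}) x, N x -> N (skew_mul (polF f) x))].

Definition left_ideal (J : skewpoly -> Prop) : Prop :=
  [/\ J 0, (forall x y, J x -> J y -> J (x + y))
         & (forall r x, J x -> J (skew_mul r x))].

Definition direct_sum_decomp (I N : skewpoly -> Prop) : Prop :=
  (forall h : skewpoly, exists x y, [/\ I x, N y & h = x + y]) /\
  (forall h : skewpoly, I h -> N h -> h = 0).

Definition Fz_direct_summand (I : skewpoly -> Prop) : Prop :=
  exists N, Fz_submodule N /\ direct_sum_decomp I N.

Definition ring_direct_summand (I : skewpoly -> Prop) : Prop :=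
  exists J, left_ideal J /\ direct_sum_decomp I J.

Definition component (a : 'I_n) (g : skewpoly) : skewpoly := skew_mul (constA (e_ a)) g.
Definition supp (g : skewpoly) : {set 'I_n} := [set a | component a g != 0].
Definition delay_free (g : skewpoly) : Prop := supp g = supp (constA (coef g 0)).

Definition in_ideal_e (i : 'I_n) (x : Aelt) : Prop := exists y : Aelt, x = y * e_ i.

Definition semi_reduced (g : skewpoly) : Prop :=
  forall a b, a \in supp g -> b \in supp g -> a != b ->
    forall i, ~ (in_ideal_e i (lead (component a g)) /\
                 in_ideal_e i (lead (component b g))).

Definition xi (g : skewpoly) : 'M[{poly F}]_n :=
  \matrix_(a < n, b < n)
    if (a <= b)%N then
      \sum_(l < sz g) (coef g (n * l + (b - a))%N b)%:P * 'X^l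
    else
      \sum_(l < sz g) (coef g (n * l + (n + b - a))%N b)%:P * 'X^(l.+1).

Definition in_calM (M : 'M[{poly F}]_n) : Prop :=
  forall a b : 'I_n, (b < a)%N -> (M a b).[0] = 0.

Definition nonzero_rows (M : 'M[{poly F}]_n) : {set 'I_n} :=
  [set a | [exists b, M a b != 0]].

Definition mx_delay_free (M : 'M[{poly F}]_n) : Prop :=
  forall a, a \in nonzero_rows M -> (M a a).[0] != 0.

Definition nz_rows_mx (M : 'M[{poly F}]_n) :
  'M[{poly F}]_(#|nonzero_rows M|, n) :=
  \matrix_(i < #|nonzero_rows M|, j < n) M (enum_val i) j.

End SkewPoly.

Definition basic (F : fieldType) (k m : nat) (B : 'M[{poly F}]_(k, m)) : Prop :=
  forall d : {poly F},
    (forall f : 'I_k -> 'I_m, injective f -> d %| \det (colsub f B)) ->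
    size d = 1%N.

Definition in_M_basic (F : finFieldType) (n : nat) (M : 'M[{poly F}]_n) : Prop :=
  [/\ in_calM M, mx_delay_free M & basic (nz_rows_mx M)].

(* Main.v *)
(** The map [xi] identifies A[z;sigma] with the subring calM of matrices over
    F[t], where t = z^n.  Put M = xi(g); every condition of the theorem amounts
    to the von Neumann regularity of g, that is, to M X M = M for some X.
    - If <g> is an F[z]-direct summand, decompose the elements with matrices
      E_1j as f_j g + y_j.  Since F[z] contains F[t], the combination of the
      y_j with coefficients in row i of M lies in both summands, hence
      vanishes; the first rows of the xi(f_j) then form X with M X M = M.
    - Delay-freeness makes M(0) upper triangular with nonzero diagonal entries
      in the nonzero rows of M, so these rows are independent and M X M = M
      gives a right inverse of the matrix B of nonzero rows.  By Bezout and the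
      Cauchy-Binet expansion, a right inverse exists if and only if B is basic.
    - A right inverse of B yields X0 over F[t] with M X0 M = M.  For any D, the
      matrix X0 + (1 - X0 M) D has the same property, and a constant upper
      triangular D that inverts M(0) on the nonzero rows brings it into calM.
    - If g x g = g, then {h | h x g = 0} is a left ideal complementing <g>. *)
Require Import Defs.
From HB Require Import structures.
From mathcomp Require Import all_boot all_order all_algebra all_field zify.
Set Implicit Arguments. Unset Strict Implicit. Unset Printing Implicit Defensive.
Import GRing.Theory.
Local Open Scope ring_scope.

(** * Right inverses and maximal minors of polynomial matrices *)

Section Minors.

(** Cauchy-Binet before sorting columns: expanding the product of sums in the Leibniz formula yields
    one term for every map [f], injective or not. *)
Lemma det_mulmx_colsub (R : comNzRingType) k m (B : 'M[R]_(k, m)) (C : 'M_(m, k)) :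
  \det (B *m C) =
  \sum_(f : {ffun 'I_k -> 'I_m}) (\prod_i C (f i) i) * \det (colsub f B).
Proof.
rewrite -det_tr {1}/determinant.
under eq_bigr => s _.
  under eq_bigr => i _ do rewrite !mxE.
  rewrite bigA_distr_bigA big_distrr /=.
  under eq_bigr => f _ do rewrite big_split /= mulrCA mulrC.
  over.
rewrite exchange_big; apply: eq_bigr => f _ /=.
rewrite -[in RHS]det_tr /determinant big_distrr; apply: eq_bigr => s _ /=.
rewrite mulrCA mulrA; congr (_ * _).
by apply: eq_bigr => i _; rewrite !mxE.
Qed.

Lemma det_colsub_noninj (R : comNzRingType) k m (B : 'M[R]_(k, m)) (f : 'I_k -> 'I_m) :
  ~~ injectiveb f -> \det (colsub f B) = 0.
Proof.
move/injectivePn => [i [j neq_ij eq_f]]; rewrite -det_tr.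
by apply: (determinant_alternate neq_ij) => l; rewrite !mxE eq_f.
Qed.

Lemma mulmx_colsub_adj (R : comNzRingType) k m (B : 'M[R]_(k, m)) (f : 'I_k -> 'I_m) :
  B *m (colsub f 1%:M *m \adj (colsub f B)) = (\det (colsub f B))%:M.
Proof. by rewrite mulmxA -mul_mx_adj mulmx_colsub mulmx1. Qed.

(** [P] is an ideal, so by Bezout it contains a gcd of the list, built one element at a time. *)
Lemma common_divisor (F : fieldType) (P : {poly F} -> Prop) (s : seq {poly F}) :
  P 0 -> (forall u v p q, P p -> P q -> P (u * p + v * q)) ->
  (forall p, p \in s -> P p) ->
  exists2 d, P d & forall p, p \in s -> d %| p.
Proof.
move=> P0 PD; elim: s => [|p s IHs] Ps; first by exists 0.
have [|d Pd dvd_s] := IHs; first by move=> q qs; apply: Ps; rewrite in_cons qs orbT.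
have [[u v] /= /andP[uv_gcd gcd_uv]] := Bezoutp p d.
exists (u * p + v * d); first by apply: PD => //; apply: Ps; rewrite mem_head.
move=> q; rewrite in_cons => /orP[/eqP->|/dvd_s].
  by apply: dvdp_trans uv_gcd _; rewrite dvdp_gcdl.
by apply: (dvdp_trans (dvdp_trans uv_gcd (dvdp_gcdr _ _))).
Qed.

(** The [d] for which [B X = d] is solvable form an ideal containing all maximal minors, by the
    adjugate formula; if [B] is basic, it contains a unit. Conversely, a common divisor of the
    minors divides [det (B C) = 1]. *)
Lemma basicP (F : fieldType) k m (B : 'M[{poly F}]_(k, m)) :
  basic B <-> exists C, B *m C = 1%:M.
Proof.
split=> [B_basic | [C BC1] d dvd_minors]; last first.
  have: d %| \det (B *m C).
    rewrite det_mulmx_colsub; apply: (big_ind (fun p => d %| p)) => [||f _].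
    - exact: dvdp0.
    - by move=> p q; apply: dvdp_add.
    apply: dvdp_mull; have [/injectiveP/dvd_minors //|] := boolP (injectiveb f).
    by move/det_colsub_noninj->; rewrite dvdp0.
  by rewrite BC1 det1 dvdp1 => /eqP.
pose P d := exists X, B *m X = d%:M.
pose s := [seq \det (colsub f B) | f : {ffun 'I_k -> 'I_m}].
have [|u v p q [X BX] [Y BY]|_ /mapP[f _ ->]|d [X BX] dvd_s] := @common_divisor F P s.
- by exists 0; rewrite mulmx0 raddf0.
- by exists (u *: X + v *: Y); rewrite mulmxDr -!scalemxAr BX BY !scale_scalar_mx raddfD.
- by eexists; apply: mulmx_colsub_adj.
have /eqP/size_poly1P[c c_neq0 d_c] : size d = 1%N.
  apply: B_basic => f _; apply: dvd_s; apply/mapP.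
  exists (finfun f); rewrite ?mem_enum //; congr (\det _).
  by apply/matrixP => i j; rewrite !mxE ffunE.
exists (c^-1%:P *: X); rewrite -scalemxAr BX d_c scale_scalar_mx.
by rewrite -polyCM mulVf.
Qed.

End Minors.

(** * Von Neumann regularity and the nonzero rows of a matrix *)

Section NonzeroRows.
Variables (F : finFieldType) (n : nat) (M : 'M[{poly F}]_n).
Local Notation T := (nonzero_rows M).

Definition rows_proj : 'M[{poly F}]_n := diag_mx (\row_a (a \in T)%:R).
Local Notation E := rows_proj.

Definition rows_sel : 'M[{poly F}]_(#|T|, n) := rowsub enum_val 1%:M.
Local Notation S := rows_sel.

Lemma rows_projM : E *m M = M.
Proof.
apply/matrixP => a b; rewrite mul_diag_mx !mxE inE.
have [_|/existsPn/(_ b)] := boolP [exists b, M a b != 0]; rewrite ?mul1r //.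
by rewrite negbK => /eqP->; rewrite mulr0.
Qed.

Lemma rows_proj_idem : E *m E = E.
Proof.
apply/matrixP => a b; rewrite mul_diag_mx !mxE.
by case: eqP => [->|_]; case: (b \in T); rewrite ?mulr1n ?mulr0n ?mulr1 ?mulr0.
Qed.

Lemma rows_selM : S *m M = nz_rows_mx M.
Proof. by apply/matrixP => i j; rewrite mul_rowsub_mx mul1mx !mxE. Qed.

Lemma rows_sel_trK : S *m S^T = 1%:M.
Proof.
apply/matrixP => i j; rewrite mul_rowsub_mx mul1mx !mxE.
by rewrite (inj_eq enum_val_inj) eq_sym.
Qed.

Lemma rows_sel_tr_mul : S^T *m S = E.
Proof.
apply/matrixP => a b; rewrite !mxE; under eq_bigr => i _ do rewrite !mxE.
have [aT|aT] := boolP (a \in T); last first.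
  rewrite mul0rn big1 // => i _; case: eqP => [ai|]; rewrite ?mul0r //.
  by rewrite -ai enum_valP in aT.
rewrite (bigD1 (enum_rank_in aT a)) //= enum_rankK_in // eqxx mul1r.
rewrite big1 ?addr0 // => i neq_i; case: eqP => [ai|]; rewrite ?mul0r //.
by case/eqP: neq_i; apply: enum_val_inj; rewrite enum_rankK_in.
Qed.

Lemma rows_sel_tr_nz : S^T *m nz_rows_mx M = M.
Proof. by rewrite -rows_selM mulmxA rows_sel_tr_mul rows_projM. Qed.

Lemma rows_sel_proj : S *m E = S.
Proof. by rewrite -rows_sel_tr_mul mulmxA rows_sel_trK mul1mx. Qed.

Hypothesis calM : in_calM M.
Hypothesis dfM : mx_delay_free M.

(** Each zero row of [M] is replaced by the unit vector of its index; at 0 the result is triangular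
    with nonzero diagonal. *)
Definition rows_compl : 'M[{poly F}]_n := M + (1%:M - E).
Local Notation U := rows_compl.

Definition at0 := @map_mx _ _ (horner_eval (0 : F)) n n.

Lemma at0_compl_upper (a b : 'I_n) : (b < a)%N -> at0 U a b = 0.
Proof.
move=> ltba; rewrite !mxE /horner_eval; have /negPf-> : a != b by rewrite -val_eqE gtn_eqF.
by rewrite !mulr0n subrr addr0 calM.
Qed.

Lemma at0_compl_diag (a : 'I_n) : at0 U a a != 0.
Proof.
rewrite !mxE /horner_eval eqxx !mulr1n hornerD.
have [aT|aT] := boolP (a \in T); first by rewrite subrr horner0 addr0 dfM.
move: aT; rewrite inE => /existsPn/(_ a); rewrite negbK => /eqP->.
by rewrite subr0 horner0 add0r -polyC1 hornerC oner_neq0.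
Qed.

Lemma det_at0_compl : \det (at0 U) != 0.
Proof.
rewrite -det_tr det_trig; last first.
  by apply/is_trig_mxP => a b ltab; rewrite mxE at0_compl_upper.
by apply/prodf_neq0 => a _; rewrite mxE at0_compl_diag.
Qed.

Lemma det_compl : \det U != 0.
Proof.
apply: contraNneq det_at0_compl => U0.
by rewrite /at0 det_map_mx U0 raddf0.
Qed.

(** Independence of the nonzero rows: the hypotheses give [v U = 0], and [det U] is nonzero. *)
Lemma compl_inj m (v : 'M_(m, n)) : v *m M = 0 -> v *m E = v -> v = 0.
Proof.
move=> vM vE.
have: v *m U *m \adj U = 0 by rewrite mulmxDr mulmxBr vM vE mulmx1 subrr addr0 mul0mx.
rewrite -mulmxA mul_mx_adj mul_mx_scalar => /matrixP v0.
apply/matrixP => i j; have := v0 i j; rewrite !mxE => /eqP.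
by rewrite mulf_eq0 (negPf det_compl) => /eqP.
Qed.

(** Induction on the column [b]: in entry [(a, b)] of [V W = 1], earlier columns of [V] vanish by
    induction and later rows of [W] by triangularity, leaving [V a b * W b b = 0]. *)
Lemma upper_inv (V W : 'M[F]_n) :
  (forall a b : 'I_n, (b < a)%N -> W a b = 0) -> (forall a, W a a != 0) ->
  V *m W = 1%:M -> forall a b : 'I_n, (b < a)%N -> V a b = 0.
Proof.
move=> W_up W_diag VW a; suff: forall N (b : 'I_n), (b < N)%N -> (b < a)%N -> V a b = 0.
  by move=> H b; apply: (H b.+1).
elim=> // N IH b; rewrite ltnS => leN ltba.
have /matrixP/(_ a b) := VW; rewrite !mxE (bigD1 b) //= big1 => [|c neq_cb].
  have /negPf-> : a != b by rewrite -val_eqE gtn_eqF.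
  by rewrite addr0 mulr0n => /eqP; rewrite mulf_eq0 (negPf (W_diag b)) orbF => /eqP.
have [ltcb|ltbc|/val_inj eq_cb] := ltngtP c b.
- by rewrite IH ?mul0r ?(leq_trans ltcb leN) // (ltn_trans ltcb ltba).
- by rewrite W_up ?mulr0.
- by rewrite eq_cb eqxx in neq_cb.
Qed.

Lemma regular_of_basic : basic (nz_rows_mx M) ->
  exists2 X, in_calM X & M *m X *m M = M.
Proof.
case/basicP => C BC.
have MX0 : M *m (C *m S) = E.
  by rewrite -{1}rows_sel_tr_nz -mulmxA [nz_rows_mx _ *m _]mulmxA BC mul1mx rows_sel_tr_mul.
pose W := at0 U; pose V := invmx W.
have VW : V *m W = 1%:M by rewrite mulVmx // unitmxE unitfE det_at0_compl.
have WV : W *m V = 1%:M by apply: mulmx1C.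
have V_up := upper_inv at0_compl_upper at0_compl_diag VW.
pose D : 'M[{poly F}]_n := map_mx polyC V *m E.
have at0M A B : at0 (A *m B) = at0 A *m at0 B by rewrite /at0 map_mxM.
have at0B A B : at0 (A - B) = at0 A - at0 B by rewrite /at0 map_mxB.
have at0D : at0 D = V *m at0 E.
  rewrite at0M; congr (_ *m _); apply/matrixP => a b.
  by rewrite !mxE /horner_eval hornerC.
have EU : E *m U = M.
  by rewrite mulmxDr mulmxBr mulmx1 rows_proj_idem subrr addr0 rows_projM.
(* Since [M = E U], the product at 0 is [E U(0) V E], where [V] inverts [U(0)]. *)
have MD0 : at0 M *m at0 D = at0 E.
  by rewrite -{1}EU at0M at0D -mulmxA [at0 U *m _]mulmxA WV mul1mx -at0M rows_proj_idem.
exists (C *m S + (D - C *m S *m M *m D)); last first.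
  rewrite mulmxDr mulmxBr !mulmxA -[M *m C *m S]mulmxA MX0 rows_projM subrr addr0.
  by rewrite rows_projM.
move=> a b ltba.
(* At 0 the factor [M D] becomes [E] and [S E = S], so the first and last terms cancel and only the
   upper triangular [V E] remains. *)
suff /matrixP/(_ a b) : at0 (C *m S + (D - C *m S *m M *m D)) = V *m at0 E.
  rewrite mxE /horner_eval => ->; rewrite /at0 map_diag_mx mul_mx_diag mxE.
  by rewrite V_up // mul0r.
rewrite /at0 map_mxD -!/(at0 _) at0B -[C *m S *m M *m D]mulmxA.
rewrite [at0 (C *m S *m _)]at0M [at0 (M *m D)]at0M MD0 -at0M.
by rewrite -[C *m S *m E]mulmxA rows_sel_proj at0D addrCA subrr addr0.
Qed.

(** The defect [v] of the candidate right inverse satisfies [v S M = 0] by regularity, so [v S = 0]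
    by independence of the rows, and [S] has right inverse [S^T]. *)
Lemma basic_of_regular X : M *m X *m M = M -> basic (nz_rows_mx M).
Proof.
move=> MXM; apply/basicP; exists (X *m S^T); rewrite -rows_selM.
apply/eqP; rewrite -subr_eq0; set v := _ - _.
have vS : v *m S = 0.
  apply: compl_inj; last by rewrite -mulmxA rows_sel_proj.
  rewrite mulmxBl mul1mx mulmxBl -!mulmxA [S^T *m _]mulmxA rows_sel_tr_mul.
  by rewrite rows_projM [M *m _]mulmxA MXM subrr.
by rewrite -[v]mulmx1 -rows_sel_trK mulmxA vS mul0mx.
Qed.

End NonzeroRows.

(** * Products with matrix units *)

Lemma mul_delta_mxE (R : pzRingType) n (i j a b : 'I_n) (A : 'M[R]_n) :
  (delta_mx i j *m A) a b = if a == i then A j b else 0.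
Proof.
rewrite mxE (bigD1 j) //= big1 => [|l neq_l]; rewrite !mxE.
  by rewrite eqxx andbT addr0; case: eqP; rewrite ?mul1r ?mul0r.
by rewrite (negPf neq_l) andbF mul0r.
Qed.

Lemma mul_delta_mx_sum (R : pzRingType) n (i j : 'I_n) (A : 'M[R]_n) :
  delta_mx i j *m A = \sum_l A j l *: delta_mx i l.
Proof.
apply/matrixP => a b; rewrite mul_delta_mxE summxE (bigD1 b) //= big1 => [|l neq_l].
  by rewrite addr0 !mxE eqxx andbT; case: eqP; rewrite ?mulr1 ?mulr0.
by rewrite !mxE [b == l]eq_sym (negPf neq_l) andbF mulr0.
Qed.

(** * [xi] as a ring isomorphism onto calM *)

Section Xi.
Variables (F : finFieldType) (n : nat).
Implicit Types (p q g : skewpoly F n) (a b : 'I_n) (M : 'M[{poly F}]_n).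

Lemma ord_subK b k : ((ord_sub b k + k) %% n)%N = b.
Proof.
have n_gt0 := ord_pos b; have lt_r := ltn_pmod k n_gt0.
have eq_k : (b + (n - k %% n) + k = (k %/ n).+1 * n + b)%N.
  by rewrite {2}(divn_eq k n) mulSn; lia.
by rewrite /= modnDml eq_k modnMDl modn_small.
Qed.

Lemma ord_sub_eq a b k : ((a + k) %% n)%N = b -> ord_sub b k = a.
Proof.
have n_gt0 := ord_pos b; have lt_r := ltn_pmod k n_gt0.
have eq_k : (a + k + (n - k %% n) = (k %/ n).+1 * n + a)%N.
  by rewrite {1}(divn_eq k n) mulSn; lia.
by move=> def_b; apply: val_inj; rewrite /= -def_b modnDml eq_k modnMDl modn_small.
Qed.

Lemma sigma_powE j (u : Aelt F n) a : sigma_pow j u a = u (ord_sub a j).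
Proof.
elim: j a => [|j IHj] a; first by rewrite (@ord_sub_eq a) // addn0 modn_small.
rewrite /sigma_pow iterS ffunE -/(sigma_pow j u) IHj; congr (u _); apply/esym.
by apply: ord_sub_eq; rewrite -[j.+1]addn1 addnA -modnDml ord_subK ord_subK.
Qed.

Lemma coef_sz p b k : (sz p <= k)%N -> (p b)`_k = 0.
Proof.
by move=> le_k; rewrite nth_default // (leq_trans _ le_k) // (bigmax_sup b).
Qed.

Lemma coef_skew_mul p q b k : (skew_mul p q b)`_k =
  \sum_(i < k.+1) (p (ord_sub b (k - i)))`_i * (q b)`_(k - i).
Proof.
rewrite ffunE coef_poly; case: ltnP => [_|le_k].
  by rewrite sum_ffunE; apply: eq_bigr => i _; rewrite !ffunE sigma_powE ffunE.
(* The truncation in [mk] loses nothing: for [k >= sz p + sz q], either [i >= sz p] or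
   [k - i >= sz q]. *)
rewrite big1 // => i _; have [le_i|lt_i] := leqP (sz p) i; first by rewrite coef_sz ?mul0r.
by rewrite (@coef_sz q) ?mulr0 //; have := ltn_ord i; lia.
Qed.

(** The coefficient of [t^e] in entry [(a, b)] is that of [z^k e_b] with
    [a + k = n e + b]; the test guards the truncated subtraction. *)
Lemma coef_xi p a b e :
  (xi p a b)`_e = if (a <= n * e + b)%N then (p b)`_(n * e + b - a) else 0.
Proof.
have n_gt0 := ord_pos a.
have polyE (c : nat -> F) : \sum_(l < sz p) (c l)%:P * 'X^l = \poly_(l < sz p) c l.
  by rewrite poly_def; apply: eq_bigr => l _; rewrite mul_polyC.
have overflow k : (sz p <= k)%N -> (sz p <= n * k)%N.
  by move/leq_trans; apply; apply: leq_pmull.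
rewrite mxE; case: leqP => [leab|ltba].
  rewrite (leq_trans leab (leq_addl _ _)) -addnBA //.
  rewrite (polyE (fun l => coef p (n * l + (b - a))%N b)) coef_poly ffunE.
  by case: ltnP => // le_e; rewrite coef_sz // (leq_trans (overflow _ le_e)) // leq_addr.
under eq_bigr => l _ do rewrite exprSr mulrA.
rewrite -mulr_suml (polyE (fun l => coef p (n * l + (n + b - a))%N b)) coefMX.
case: e => [|e] /=; first by rewrite muln0 leqNgt ltba.
have le_a : (a <= n + b)%N by rewrite ltnW // (leq_trans (ltn_ord a)) ?leq_addr.
rewrite mulnSr -[(n * e + n + b)%N]addnA (leq_trans le_a (leq_addl _ _)).
rewrite -(addnBA (n * e) le_a).
rewrite coef_poly ffunE; case: ltnP => // le_e.
by rewrite coef_sz // (leq_trans (overflow _ le_e)) // leq_addr.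
Qed.

Lemma in_calM_xi p : in_calM (xi p).
Proof. by move=> a b ltba; rewrite horner_coef0 coef_xi muln0 leqNgt ltba. Qed.

Lemma xi0 : xi (0 : skewpoly F n) = 0.
Proof.
by apply/matrixP => a b; apply/polyP => e; rewrite coef_xi !mxE !ffunE !coef0 if_same.
Qed.

Lemma xiD p q : xi (p + q) = xi p + xi q.
Proof.
apply/matrixP => a b; apply/polyP => e; rewrite [in RHS]mxE coefD !coef_xi.
by case: ifP; rewrite ?addr0 // !ffunE coefD.
Qed.

Lemma xiB p q : xi (p - q) = xi p - xi q.
Proof.
apply/matrixP => a b; apply/polyP => e.
have -> : (xi p - xi q) a b = xi p a b - xi q a b by rewrite !mxE.
rewrite coefB !coef_xi.
by case: ifP; rewrite ?subr0 // !ffunE coefB.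
Qed.

(** Each coefficient of [z^k e_b] is visible in the matrix: its row is [b - k] modulo [n], and its
    exponent is the quotient of row plus [k] by [n]. *)
Lemma xi_inj : injective (@xi F n).
Proof.
move=> p q eq_pq; apply/ffunP => b; apply/polyP => k.
have ek : (n * ((ord_sub b k + k) %/ n) + b = ord_sub b k + k)%N.
  by rewrite -[in LHS](ord_subK b k) mulnC -divn_eq.
have /matrixP/(_ (ord_sub b k) b) := eq_pq.
move/(congr1 (fun r : {poly F} => r`_(((ord_sub b k + k) %/ n)%N))).
by rewrite !coef_xi ek leq_addr addKn.
Qed.

Lemma xi_surj M : in_calM M -> exists p, xi p = M.
Proof.
move=> calM; pose N := \max_a \max_b size (M a b).
pose p : skewpoly F n := [ffun b =>
  \poly_(k < n * N) (M (ord_sub b k) b)`_(((ord_sub b k + k) %/ n)%N)].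
exists p; apply/matrixP => a b; apply/polyP => e; have n_gt0 := ord_pos a.
rewrite coef_xi; case: leqP => [le_a|]; last first.
  (* The guard fails only for [e = 0] below the diagonal, exactly where calM forces a zero
     coefficient. *)
  case: e => [|e]; first by rewrite muln0 => /calM; rewrite horner_coef0.
  rewrite mulnSr ltnNge => /negP[]; apply: leq_trans (ltnW (ltn_ord a)) _.
  by rewrite addnAC leq_addl.
have eq_k : (a + (n * e + b - a) = n * e + b)%N by rewrite subnKC.
have mod_k : ((a + (n * e + b - a)) %% n)%N = b by rewrite eq_k mulnC modnMDl modn_small.
rewrite ffunE coef_poly (ord_sub_eq mod_k) eq_k mulnC divnMDl // divn_small // addn0.
case: ltnP => // le_k; rewrite nth_default //.
apply: (@leq_trans N); first by apply: (bigmax_sup a) => //; apply: (bigmax_sup b).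
rewrite -ltnS -(ltn_pmul2l n_gt0) (leq_ltn_trans le_k) // mulnS.
by have := ltn_ord b; lia.
Qed.

(** Both sides are one sum over positions [m'] between [a] and [m]: the skew product reads [m'] as
    [a + i], the matrix product cuts the range into blocks of length [n]. *)
Lemma xi_mul p q : xi (skew_mul p q) = xi p *m xi q.
Proof.
apply/matrixP => a b; apply/polyP => e; have n_gt0 := ord_pos a.
pose m := (n * e + b)%N.
(* [m' = n f + c] encodes the middle index [c] together with the exponent [f]
   taken from the left factor. *)
pose G m' := if (a <= m' <= m)%N
  then (p (ord_sub b (m - m')))`_(m' - a) * (q b)`_(m - m') else 0.
transitivity (\sum_(0 <= m' < e.+1 * n) G m').
  have le_m : (m < e.+1 * n)%N by rewrite mulSnr mulnC ltn_add2l.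
  rewrite coef_xi -/m; case: leqP => [le_a|lt_a]; last first.
    rewrite big1 // => m' _; rewrite /G; case: ifP => // /andP[/leq_trans H /H].
    by rewrite leqNgt lt_a.
  rewrite (@big_cat_nat _ _ _ a) //=; last by rewrite (leq_trans le_a) // ltnW.
  rewrite (@big_cat_nat _ _ _ m.+1 a) //=; last by rewrite leqW.
  rewrite [X in X + _]big_nat big1 ?add0r => [|i /andP[_ lt_i]]; last
    by rewrite /G leqNgt lt_i.
  rewrite [X in _ + X]big_nat [X in _ + X]big1 ?addr0 => [|i /andP[lt_i _]]; last
    by rewrite /G andbC leqNgt lt_i.
  rewrite coef_skew_mul -(add0n a) big_addn subSn // big_mkord add0n.
  apply: eq_bigr => i _; have le_i := ltn_ord i.
  have le_im : (i + a <= m)%N by lia.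
  by rewrite /G leq_addl le_im addnK -subnDA [(a + i)%N]addnC.
rewrite big_nat_mul mxE coef_sum.
under [RHS]eq_bigr => c _ do rewrite coefM.
rewrite exchange_big big_mkord; apply: eq_bigr => f _ /=.
rewrite mulSnr addnC -{1}(add0n (f * n)%N) big_addn addnK big_mkord.
apply: eq_bigr => c _; rewrite !coef_xi [(n * f)%N]mulnC addnC /G.
have le_f : (f * n <= n * e)%N by rewrite mulnC leq_mul2l -ltnS ltn_ord orbT.
case: leqP => [le_a|] /=; last by rewrite mul0r.
rewrite mulnBr [(n * f)%N]mulnC.
have -> : (c <= n * e - f * n + b)%N = (f * n + c <= m)%N by rewrite /m; lia.
case: ifP => le_m; last by rewrite mulr0.
have -> : (n * e - f * n + b - c)%N = (m - (f * n + c))%N by rewrite /m; lia.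
congr (_ * _); congr ((p _)`__); apply: ord_sub_eq.
have -> : (c + (m - (f * n + c)) = (e - f) * n + b)%N by rewrite mulnBl /m in le_m *; lia.
by rewrite modnMDl modn_small.
Qed.

Lemma skew_mulA p q g : skew_mul (skew_mul p q) g = skew_mul p (skew_mul q g).
Proof. by apply: xi_inj; rewrite !xi_mul mulmxA. Qed.

(** Polynomials in [z^n] act as scalars, so an F[z]-submodule admits F[t]-linear combinations. *)
Lemma xi_polF (f : {poly F}) : xi (polF n (f \Po 'X^n)) = f%:M.
Proof.
apply/matrixP => a b; have n_gt0 := ord_pos a; apply/polyP => e.
rewrite coef_xi ffunE coef_comp_poly_Xn // mxE.
have [<-|neq_ab] := eqVneq a b.
  by rewrite leq_addl addnK dvdn_mulr // mulKn.
rewrite coef0; case: leqP => // le_a; case: ifP => // /dvdnP[d eq_d].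
case/eqP: neq_ab; apply: val_inj.
have : (n * e + b = d * n + a)%N by rewrite -eq_d subnK.
by move/(congr1 (modn^~ n)); rewrite mulnC !modnMDl !modn_small.
Qed.

Lemma xi_constA (c : Aelt F n) : xi (constA c) = diag_mx (\row_j (c j)%:P).
Proof.
apply/matrixP => a b; have n_gt0 := ord_pos a; apply/polyP => e.
rewrite coef_xi ffunE coefC !mxE; have [<-|neq_ab] := eqVneq a b.
  by rewrite leq_addl addnK muln_eq0 (gtn_eqF n_gt0) mulr1n coefC.
rewrite mulr0n coef0; case: leqP => // le_a; case: eqP => // eq0.
case/eqP: neq_ab; apply: val_inj.
have : (n * e + b = a)%N by rewrite -(subnK le_a) eq0.
by move/(congr1 (modn^~ n)); rewrite mulnC modnMDl !modn_small.
Qed.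

(** * Support and delay-freeness read off the matrix *)

Lemma supp_xi g : supp g = nonzero_rows (xi g).
Proof.
apply/setP => a; rewrite !inE.
have xi_comp : xi (component a g) = delta_mx a a *m xi g.
  rewrite xi_mul xi_constA; congr (_ *m _); apply/matrixP => i j; rewrite !mxE ffunE.
  by have [->|_] := eqVneq i a; rewrite ?polyC1 1?eq_sym // polyC0 mul0rn.
have <- : (xi (component a g) != 0) = (component a g != 0).
  by rewrite -xi0 (inj_eq xi_inj).
rewrite xi_comp.
apply/idP/existsP => [|[b gab]]; last first.
  apply: contra_neq gab => /matrixP/(_ a b).
  by rewrite mul_delta_mxE eqxx => ->; rewrite mxE.
have [b gab _|row0] := pickP (fun b => xi g a b != 0); first by exists b.
case/eqP; apply/matrixP => i j; rewrite mul_delta_mxE [RHS]mxE.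
by case: eqP => // _; apply/eqP/negbFE/row0.
Qed.

Lemma mx_delay_free_xi g : delay_free g -> mx_delay_free (xi g).
Proof.
rewrite /delay_free => df a; rewrite -supp_xi df supp_xi inE => /existsP[b].
rewrite xi_constA horner_coef0 coef_xi muln0 leqnn subnn !mxE.
by apply: contraNneq => g0; rewrite ffunE g0 polyC0 mul0rn.
Qed.

(** * Regularity and direct summands *)

Lemma ring_direct_summand_of_regular g x :
  skew_mul (skew_mul g x) g = g -> ring_direct_summand (gen_ideal g).
Proof.
move=> gxg; have xi_gxg : xi g *m xi x *m xi g = xi g by rewrite -!xi_mul gxg.
(* This is the kernel of the left-linear projection [h -> h x g] onto the ideal generated by [g]. *)
exists (fun h => skew_mul (skew_mul h x) g = 0); split.
  split=> [|h k h0 k0|r h h0]; last 1 first.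
  - rewrite 2!skew_mulA -[skew_mul h _]skew_mulA h0; apply: xi_inj.
    by rewrite xi_mul xi0 mulmx0.
  - by apply: xi_inj; rewrite !xi_mul xi0 !mul0mx.
  - by apply: xi_inj; rewrite !xi_mul xiD !mulmxDl -!xi_mul h0 k0 xi0 addr0.
split=> [h|h [f ->] fg0]; last by rewrite -fg0 !skew_mulA -[skew_mul g _]skew_mulA gxg.
exists (skew_mul (skew_mul h x) g), (h - skew_mul (skew_mul h x) g); split.
- by exists (skew_mul h x).
- apply: xi_inj; rewrite !xi_mul xiB !xi_mul xi0 !mulmxBl -!mulmxA.
  by rewrite [xi g *m _]mulmxA xi_gxg subrr.
- by rewrite addrC subrK.
Qed.

Lemma regular_of_Fz_direct_summand g : (0 < n)%N ->
  Fz_direct_summand (gen_ideal g) -> exists X, xi g *m X *m xi g = xi g.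
Proof.
move=> n_gt0 [N [[N0 ND NZ] [dec disj]]]; pose o := Ordinal n_gt0.
(* Matrix units of the first row lie in calM, as that row has no entry below the diagonal. *)
have [h h_delta] : exists h : 'I_n -> skewpoly F n, forall j, xi (h j) = delta_mx o j.
  apply: (fin_all_exists (P := fun j h => xi h = delta_mx o j)) => j.
  apply: xi_surj => a b ltba; rewrite mxE.
  by case: eqP ltba => [->|]; rewrite ?ltn0 //= horner0.
have [f f_dec] : exists f : 'I_n -> skewpoly F n, forall j,
    exists2 y, N y & h j = skew_mul (f j) g + y.
  apply: (fin_all_exists (P := fun j f => exists2 y, N y & h j = skew_mul f g + y)) => j.
  by have [_ [y [[f ->] Ny ->]]] := dec (h j); exists f, y.
have [y Ny h_fy] : exists2 y : 'I_n -> skewpoly F n,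
    forall j, N (y j) & forall j, h j = skew_mul (f j) g + y j.
  exact: (fin_all_exists2 (P := fun _ => N)
    (Q := fun j z => h j = skew_mul (f j) g + z)).
pose P i j := polF n (xi g i j \Po 'X^n).
have xi_sum (G : 'I_n -> skewpoly F n) : xi (\sum_j G j) = \sum_j xi (G j).
  by apply: (big_morph (@xi F n)); [apply: xiD | apply: xi0].
have xi_y j : xi (y j) = delta_mx o j - xi (f j) *m xi g.
  by rewrite -h_delta h_fy xiD xi_mul addrAC subrr add0r.
have xi_P i j (Y : 'M_n) : xi (P i j) *m Y = xi g i j *: Y by rewrite xi_polF mul_scalar_mx.
(* As [h i * g] is the sum of the [P i j * h j], this sum equals [(h i - \sum_j P i j * f j) * g];
   it also lies in [N]. *)
have Py0 i : \sum_j skew_mul (P i j) (y j) = 0.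
  apply: disj; last by apply: (big_ind N) => // j _; apply: NZ.
  exists (h i - \sum_j skew_mul (P i j) (f j)); apply: xi_inj.
  rewrite xi_mul xiB mulmxBl !xi_sum h_delta mul_delta_mx_sum mulmx_suml -sumrB.
  by apply: eq_bigr => j _; rewrite !xi_mul xi_y mulmxBr mulmxA !xi_P.
exists (\matrix_(j, l) xi (f j) o l).
have row_xi i : delta_mx o i *m xi g = \sum_j xi g i j *: (xi (f j) *m xi g).
  apply/eqP; rewrite mul_delta_mx_sum -subr_eq0 -sumrB; apply/eqP.
  have := congr1 (@xi F n) (Py0 i); rewrite xi_sum xi0 => {2}<-.
  by apply: eq_bigr => j _; rewrite xi_mul xi_y xi_P scalerBr.
apply/matrixP => i b; have /matrixP/(_ o b) := row_xi i.
rewrite mul_delta_mxE eqxx summxE => ->.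
rewrite -mulmxA mxE; apply: eq_bigr => j _; rewrite [in RHS]mxE; congr (_ * _).
by rewrite !mxE; apply: eq_bigr => l _; rewrite mxE.
Qed.

End Xi.

Theorem theorem4p1 (F : finFieldType) (n : nat) (g : skewpoly F n) :
  (2 <= n)%N -> (n %| #|F|.-1)%N ->
  delay_free g -> semi_reduced g ->
  (Fz_direct_summand (gen_ideal g) <-> ring_direct_summand (gen_ideal g)) /\
  (ring_direct_summand (gen_ideal g) <-> in_M_basic (xi g)).
Proof.
move=> n_ge2 _ /mx_delay_free_xi df _; have calM := @in_calM_xi _ _ g.
have basic_ring : in_M_basic (xi g) -> ring_direct_summand (gen_ideal g).
  case=> _ _ /(regular_of_basic calM df)[_ /xi_surj[x <-] gxg].
  by apply: (@ring_direct_summand_of_regular _ _ _ x); apply: xi_inj; rewrite !xi_mul.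
have Fz_basic : Fz_direct_summand (gen_ideal g) -> in_M_basic (xi g).
  case/(regular_of_Fz_direct_summand (ltnW n_ge2)) => X gXg.
  by split=> //; apply: (basic_of_regular calM df gXg).
have ring_Fz : ring_direct_summand (gen_ideal g) -> Fz_direct_summand (gen_ideal g).
  by case=> J [[J0 JD JM] dec]; exists J; do 2!split=> //; move=> f; apply: JM.
by do 2!split; auto.
Qed.
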